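(* Let $n$ and $k$ be positive integers with $n \geq 19k-2$. If $T$ is a tournament on $n$ vertices, then $\mathrm{sinv}'_k(T) \leq \mathrm{sinv}_k(T) \leq 1$.
   Context: A tournament is an orientation of a complete graph. For a digraph $D$ and $X \subseteq V(D)$, inverting $X$ means reversing the direction of every arc of $D$ with both endvertices in $X$. A digraph $D$ is $k$-arc-strong if for every partition $(V_1,V_2)$ of $V(D)$ into nonempty sets there are at least $k$ arcs from $V_1$ to $V_2$; it is $k$-strong if $|V(D)|\ge k+1$ and $D-S$ is strongly connected for every $S\subseteq V(D)$ with $|S|<k$. $\mathrm{sinv}'_k(D)$ (resp. $\mathrm{sinv}_k(D)$) is the minimum number of sets whose successive inversion transforms $D$ into a $k$-arc-strong (resp. $k$-strong) digraph. *)

(* Defs.v *)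
From mathcomp Require Import all_boot.
Set Implicit Arguments. Unset Strict Implicit. Unset Printing Implicit Defensive.

Section Digraphs.
Variable n : nat.
Local Notation V := 'I_n.

Definition tournament (D : rel V) : Prop :=
  (forall u, ~~ D u u) /\
  (forall u v, u != v -> (D u v || D v u) && ~~ (D u v && D v u)).

Definition invert (D : rel V) (X : {set V}) : rel V :=
  fun u v => if (u \in X) && (v \in X) then D v u else D u v.

Definition invert_seq (D : rel V) (Xs : seq {set V}) : rel V :=
  foldl invert D Xs.

Definition arc_strong (k : nat) (D : rel V) : Prop :=
  forall A : {set V}, A != set0 -> A != setT ->
    k <= #|[set p : V * V | [&& p.1 \in A, p.2 \notin A & D p.1 p.2]]|.

Definition strong_minus (D : rel V) (S : {set V}) : Prop :=
  forall u v, u \notin S -> v \notin S ->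
    connect [rel x y | [&& D x y, x \notin S & y \notin S]] u v.

Definition vertex_strong (k : nat) (D : rel V) : Prop :=
  k.+1 <= n /\ forall S : {set V}, #|S| < k -> strong_minus D S.

Definition is_min_inv (P : rel V -> Prop) (D : rel V) (m : nat) : Prop :=
  (exists Xs : seq {set V}, size Xs = m /\ P (invert_seq D Xs)) /\
  (forall Xs : seq {set V}, P (invert_seq D Xs) -> m <= size Xs).

Definition is_sinv_arc (k : nat) (D : rel V) (m : nat) : Prop :=
  is_min_inv (arc_strong k) D m.
Definition is_sinv (k : nat) (D : rel V) (m : nat) : Prop :=
  is_min_inv (vertex_strong k) D m.
End Digraphs.

(* Main.v *)
(* Call [(A, B)] a cut if no arc goes from [A] to [B] and fewer than [k] vertices
   lie outside [A] and [B].  If some [P] with [k] vertices dominates some [C] with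
   [6 * k] vertices, let [Q] be the last [2 * k - 1] vertices of a median order of
   [C]: inverting [P :|: Q] makes [P :|: C] [k]-strong, and every other vertex gets
   [k] in- and out-neighbours in [P :|: C] if it is suitably put inside or outside
   the inverted set.
   In general, with [d] about [3 * k / 2], one can invert a set [X] of at most
   [4 * d] vertices so that all degrees are at least [d].  If the result has a cut
   [(A, B)], then say [A] has [6 * k] vertices outside [X]; they are dominated by
   [B] in the original tournament, so either the first case (or its dual) applies
   or [B] has fewer than [k] vertices, and then some vertex of [B] has in-degree
   less than [d]. *)

Require Import Defs.
From mathcomp Require Import all_boot.
From mathcomp Require Import zify.
Set Implicit Arguments. Unset Strict Implicit. Unset Printing Implicit Defensive.

(** * Finite sets and paths leaving a set *)

Section FiniteSets.
Variable V : finType.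
Implicit Types A B S W X : {set V}.

Lemma exists_notin S W : #|S| < #|W| -> exists2 x, x \in W & x \notin S.
Proof.
move=> ltSW; have /subsetPn[x] : ~~ (W \subset S).
  by apply: contraL ltSW => /subset_leq_card; rewrite -leqNgt.
by exists x.
Qed.

Lemma exists_card_between A B m : A \subset B -> #|A| <= m <= #|B| ->
  exists X, [/\ A \subset X, X \subset B & #|X| = m].
Proof.
move=> sAB; elim: m => [|m IHm] /andP[leAm lemB].
  by exists A; split=> //; apply/eqP; rewrite -leqn0.
case: (ltngtP #|A| m.+1) leAm => // [ltAm _|eqA _]; last by exists A.
have [|X [sAX sXB cX]] := IHm; first by rewrite -ltnS ltAm ltnW.
have [|x xB xX] := @exists_notin X B; first by rewrite cX.
exists (x |: X); split; last by rewrite cardsU1 xX cX.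
  exact: subset_trans sAX (subsetUr _ _).
by rewrite subUset sub1set xB.
Qed.

Lemma connect_exit (e : rel V) A u v : connect e u v -> u \in A -> v \notin A ->
  exists x y, [/\ x \in A, y \notin A & e x y].
Proof.
case/connectP=> p; elim: p u => [|w p IHp] u /=; first by move=> _ -> ->.
case/andP=> euw pwp vE uA vA; have [wA|wA] := boolP (w \in A).
  exact: IHp wA vA.
by exists u, w.
Qed.

End FiniteSets.

(** * Median orders *)

Section MedianOrder.
Variables (V : eqType) (D : rel V).
Implicit Types p q r s t : seq V.

Fixpoint forward_arcs s : nat :=
  if s is x :: s' then count (D x) s' + forward_arcs s' else 0.

Definition median s := forall t, perm_eq t s -> forward_arcs t <= forward_arcs s.

Lemma median_exists s : exists2 t, perm_eq t s & median t.
Proof.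
pose P m := has (fun t => forward_arcs t == m) (permutations s).
have exP : exists m, P m.
  exists (forward_arcs s); apply/hasP; exists s => //.
  by rewrite mem_permutations.
have arcs_le t : forward_arcs t <= size t ^ 2.
  elim: t => //= x t IHt; have := count_size (D x) t; lia.
have ubP m : P m -> m <= size s ^ 2.
  case/hasP=> t; rewrite mem_permutations => /perm_size <- /eqP <-.
  exact: arcs_le.
case: (ex_maxnP exP ubP) => m /hasP[t].
rewrite mem_permutations => pts /eqP <- maxt; exists t => // u put.
apply: maxt; apply/hasP; exists u => //.
by rewrite mem_permutations (perm_trans put).
Qed.

(** Only the pairs formed by [x] and a member of [q] change their order; adding on both sides avoids
    truncated subtraction. *)
Lemma forward_arcs_shift p x q r :
  forward_arcs (p ++ x :: q ++ r) + count (D^~ x) q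
  = forward_arcs (p ++ q ++ x :: r) + count (D x) q.
Proof.
elim: p => [|y p IHp] /=; last first.
  have /permP-> : perm_eq (p ++ x :: q ++ r) (p ++ q ++ x :: r).
    by rewrite perm_cat2l -cat1s perm_catCA.
  lia.
rewrite count_cat; elim: q => [|y q IHq] /=; first by lia.
have /permP-> : perm_eq (q ++ x :: r) (x :: q ++ r).
  by rewrite -cat1s perm_catCA.
rewrite /= count_cat; lia.
Qed.

(** The feedback property: otherwise moving [x] behind [q] would gain forward arcs. [median_in] is
    its mirror image. *)
Lemma median_out p x q r : median (p ++ x :: q ++ r) ->
  count (D^~ x) q <= count (D x) q.
Proof.
move=> med; have := forward_arcs_shift p x q r.
suff /med : perm_eq (p ++ q ++ x :: r) (p ++ x :: q ++ r) by lia.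
by rewrite perm_cat2l -cat1s perm_catCA.
Qed.

Lemma median_in p x q r : median (p ++ q ++ x :: r) ->
  count (D x) q <= count (D^~ x) q.
Proof.
move=> med; have := forward_arcs_shift p x q r.
suff /med : perm_eq (p ++ x :: q ++ r) (p ++ q ++ x :: r) by lia.
by rewrite perm_cat2l perm_sym -cat1s perm_catCA.
Qed.

End MedianOrder.

(** * Degrees and inversions in tournaments *)

Section Tournaments.
Variable V : finType.
Implicit Types (D : rel V) (A B C P Q S U X Y : {set V}) (k d : nat).

(* [is_tournament] and [flip] are [tournament] and [invert] on an arbitrary
   finite type; on ['I_n] they are convertible to them. *)
Definition is_tournament D : Prop :=
  (forall u, ~~ D u u) /\
  (forall u v, u != v -> (D u v || D v u) && ~~ (D u v && D v u)).

Definition flip D X : rel V :=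
  fun u v => if (u \in X) && (v \in X) then D v u else D u v.

Definition conv D : rel V := fun u v => D v u.

(** This is an out-degree; in-degrees are written with [conv D], so that bounds can be dualised. *)
Definition deg D U v := #|[set u in U | D v u]|.

Definition low_degree D e :=
  [set v | (deg D setT v < e) || (deg (conv D) setT v < e)].

Definition cut k D A B :=
  [&& A != set0, B != set0, [disjoint A & B], #|~: (A :|: B)| < k
    & [forall a in A, forall b in B, ~~ D a b]].

Lemma tournament_conv D : is_tournament D -> is_tournament (conv D).
Proof.
case=> irr tot; split=> [u|u v uv]; rewrite /conv ?irr //.
by rewrite orbC andbC [D v u && _]andbC andbC tot.
Qed.

Lemma tournament_flip D X : is_tournament D -> is_tournament (flip D X).
Proof.
case=> irr tot; split=> [u|u v uv]; rewrite /flip; first by case: ifP.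
rewrite (andbC (v \in X)); case: ifP => _; apply: tot => //.
by rewrite eq_sym.
Qed.

Lemma tournamentC D u v : is_tournament D -> u != v -> D v u = ~~ D u v.
Proof. by case=> _ tot /tot; case: (D u v); case: (D v u). Qed.

Lemma flip_conv D X u v : flip (conv D) X u v = conv (flip D X) u v.
Proof. by rewrite /conv /flip andbC. Qed.

Lemma eq_deg D D' U v : {in U, D v =1 D' v} -> deg D U v = deg D' U v.
Proof.
move=> eqD; apply: eq_card => u; rewrite !inE.
by case uU: (u \in U) => //=; apply: eqD.
Qed.

Lemma deg_flip_conv D X U v : deg (flip (conv D) X) U v = deg (conv (flip D X)) U v.
Proof. by apply: eq_deg => u _; rewrite flip_conv. Qed.

Lemma deg_conv_flip_conv D X U v : deg (conv (flip (conv D) X)) U v = deg (flip D X) U v.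
Proof. by apply: eq_deg => u _; rewrite /conv flip_conv. Qed.

Lemma deg_sub D U U' v : U \subset U' -> deg D U v <= deg D U' v.
Proof.
move=> sUU; apply: subset_leq_card; apply/subsetP=> u; rewrite !inE.
by case/andP=> /(subsetP sUU) -> ->.
Qed.

Lemma deg_le_card D U v : deg D U v <= #|U|.
Proof. by apply: subset_leq_card; apply/subsetP=> u; rewrite inE => /andP[]. Qed.

Lemma deg_setU D U U' v : [disjoint U & U'] ->
  deg D (U :|: U') v = deg D U v + deg D U' v.
Proof.
move=> disU; rewrite /deg -cardsUI.
rewrite [in X in _ + X](_ : _ :&: _ = set0) ?cards0 ?addn0.
  by apply: eq_card => u; rewrite !inE andb_orl.
apply/setP=> u; rewrite !inE; case uU: (u \in U) => //=.
by rewrite (disjointFr disU uU) andbF.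
Qed.

Lemma deg_setT D X v : deg D setT v = deg D X v + deg D (~: X) v.
Proof. by rewrite -deg_setU ?setUCr // disjoints_subset setCK. Qed.

Lemma deg_conv D U v : is_tournament D ->
  deg D U v + deg (conv D) U v = #|U :\ v|.
Proof.
move=> tD; rewrite /deg -cardsUI.
rewrite [in X in _ + X](_ : _ :&: _ = set0) ?cards0 ?addn0.
  apply: eq_card => u; rewrite !inE -andb_orr andbC; congr (_ && _).
  have [-> |uv] := eqVneq u v; first by rewrite /conv (negPf (tD.1 v)).
  by rewrite /conv (tournamentC tD uv) orNb.
apply/setP=> u; rewrite !inE; have [-> |uv] := eqVneq u v.
  by rewrite (negPf (tD.1 v)) !andbF.
by rewrite /conv (tournamentC tD uv); case: (D u v); rewrite ?andbF.
Qed.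

Lemma deg_flip_out D X U v : v \notin X -> deg (flip D X) U v = deg D U v.
Proof. by move=> vX; apply: eq_deg => u _; rewrite /flip (negPf vX). Qed.

Lemma deg_flip_in D X v : v \in X ->
  deg (flip D X) setT v = deg (conv D) X v + deg D (~: X) v.
Proof.
move=> vX; rewrite (deg_setT _ X); congr (_ + _); apply: eq_deg => u; rewrite ?inE.
  by move=> uX; rewrite /flip vX uX.
by move=> uX; rewrite /flip (negPf uX) andbF.
Qed.

(** * Vertices of low degree *)

Lemma exists_low_deg D U : is_tournament D -> U != set0 ->
  exists2 v, v \in U & 2 * deg D U v < #|U|.
Proof.
move=> tD U0; case: (pickP [pred v in U | 2 * deg D U v < #|U|]) => [v|noV].
  by case/andP=> vU lt; exists v.
have sum_conv : \sum_(v in U) deg (conv D) U v = \sum_(v in U) deg D U v.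
  have degE D' v : deg D' U v = \sum_(u in U) D' v u.
    by rewrite /deg -sum1dep_card big_mkcondr.
  under eq_bigr do rewrite degE.
  under [RHS]eq_bigr do rewrite degE.
  exact: exchange_big.
(* In- and out-degrees inside [U] have equal sums and add up to [#|U|.-1] at each vertex, so twice
   the out-degree averages below [#|U|]. *)
have sum_deg : \sum_(v in U) (2 * deg D U v) = #|U| * #|U|.-1.
  rewrite -big_distrr /= mul2n -addnn -{2}sum_conv -big_split /=.
  rewrite -sum_nat_const; apply: eq_bigr => v vU.
  by rewrite deg_conv // (cardsD1 v U) vU.
have : #|U| * #|U| <= \sum_(v in U) (2 * deg D U v).
  rewrite -sum_nat_const; apply: leq_sum => v vU.
  by have := noV v; rewrite /= vU /= => /negbT; rewrite -leqNgt.
rewrite sum_deg leq_pmul2l ?card_gt0 // => le.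
by move: U0; rewrite -card_gt0; lia.
Qed.

(** Some vertex of this set has at least half of the others as out-neighbours, yet fewer than [d] of
    them. *)
Lemma card_low_deg D d : is_tournament D ->
  #|[set v | deg D setT v < d]| <= 2 * d.
Proof.
move=> tD; set U := finset _; have [->|U0] := eqVneq U set0; first by rewrite cards0.
have [v vU lt] := exists_low_deg (tournament_conv tD) U0.
have := deg_conv U v tD; have := cardsD1 v U; rewrite vU.
have := deg_sub D v (subsetT U); have : deg D setT v < d by move: vU; rewrite inE.
lia.
Qed.

Lemma card_low_degree D d : is_tournament D -> #|low_degree D d| <= 4 * d.
Proof.
move=> tD; have := card_low_deg d tD; have := card_low_deg d (tournament_conv tD).
set I := finset _; set O := finset _.
have -> : low_degree D d = O :|: I by apply/setP=> v; rewrite !inE.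
have := cardsUI O I; lia.
Qed.

(** * Cuts, and inversion when a large set is dominated *)

Lemma cutP k D A B : reflect
  [/\ A != set0, B != set0, [disjoint A & B], #|~: (A :|: B)| < k
    & forall a b, a \in A -> b \in B -> ~~ D a b] (cut k D A B).
Proof.
apply: (iffP and5P) => -[A0 B0 AB cS noarc]; split=> //.
  by move=> a b aA bB; have /'forall_in_forall_inP := noarc; apply.
by apply/'forall_in_forall_inP => a aA b bB; apply: noarc.
Qed.

Lemma cut_conv k D A B : cut k D A B -> cut k (conv D) B A.
Proof.
case/cutP=> A0 B0 AB cS noarc; apply/cutP.
by split; rewrite // 1?disjoint_sym 1?setUC // => b a bB aA; apply: noarc.
Qed.

Lemma eq_cut k D D' A B : D =2 D' -> cut k D A B -> cut k D' A B.
Proof.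
move=> eqD /cutP[A0 B0 AB cS noarc]; apply/cutP; split=> // a b aA bB.
by rewrite -eqD noarc.
Qed.

Lemma in_setUC_l A B v : v \notin ~: (A :|: B) -> v \notin A -> v \in B.
Proof. by rewrite !inE negbK => /orP[->|]. Qed.

Lemma in_setUC_r A B v : v \notin ~: (A :|: B) -> v \notin B -> v \in A.
Proof. by rewrite !inE negbK => /orP[|->]. Qed.

(** The last clause stands in for paths from [Y] to [Q]: deleting fewer than [k] vertices never
    traps a nonempty part of [Y] inside [C]. *)
Lemma median_split D C k : is_tournament D -> 0 < k -> 6 * k <= #|C| ->
  exists Y Q, [/\ C = Y :|: Q, [disjoint Y & Q], k <= #|Q|, 2 * k <= #|Y|
    & {in Q, forall q, k <= deg (conv D) Y q} /\
      (forall A S, A != set0 -> A \subset Y -> #|S| < k ->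
         exists a b, [/\ a \in A, b \in C, b \notin A, b \notin S & D a b])].
Proof.
move=> tD k0 cC; have [s psC meds] := median_exists D (enum C).
have us : uniq s by rewrite (perm_uniq psC) enum_uniq.
have ms x : (x \in s) = (x \in C) by rewrite (perm_mem psC) mem_enum.
have ss : size s = #|C| by rewrite (perm_size psC) cardE.
pose m := #|C| - (2 * k - 1); pose y := take m s; pose q := drop m s.
have sE : s = y ++ q by rewrite cat_take_drop.
have sy : size y = m by rewrite size_takel // ss leq_subr.
have sq : size q = 2 * k - 1 by rewrite size_drop ss; lia.
move: us; rewrite sE cat_uniq => /and3P[uy /hasPn yq uq].
have cy : #|[set x in y]| = m by rewrite cardsE -sy; apply/card_uniqP.
have cq : #|[set x in q]| = 2 * k - 1 by rewrite cardsE -sq; apply/card_uniqP.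
have count_out x (t : seq V) : x \notin t -> count (D x) t + count (D^~ x) t = size t.
  elim: t => //= z t IHt; rewrite inE negb_or => /andP[xz /IHt <-].
  rewrite (tournamentC tD xz); case: (D x z) => /=; lia.
exists [set x in y], [set x in q]; split; rewrite ?cy ?cq; try (rewrite /m; lia).
- by apply/setP=> x; rewrite -ms sE mem_cat !inE.
- by apply/pred0P=> x /=; rewrite !inE; apply/negP=> /andP[xy /yq]; rewrite /= xy.
split.
  (* At least half of the [m + size q1] predecessors of [x] are in-neighbours, so at least
     [(m - size q1) / 2] of these lie in [y], where [m > 4 * k] and [size q1 <= 2 * k - 2]. *)
  move=> x; rewrite inE => xq; case/splitPr: xq sE sq uq yq => q1 q2 sE sq uq yq.
  have := @median_in _ D [::] x (y ++ q1) q2; rewrite /= -catA -sE => /(_ meds).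
  have xy : x \notin y by apply: yq; rewrite mem_cat inE eqxx orbT.
  rewrite !count_cat; have := count_out x y xy; have := count_size (D^~ x) q1.
  have -> : deg (conv D) [set x in y] x = count (D^~ x) y.
    rewrite /deg -size_filter -(card_uniqP (filter_uniq _ uy)).
    by apply: eq_card => z; rewrite !inE mem_filter andbC.
  move: sq; rewrite size_cat /= sy /m; lia.
move=> A S A0 sAY cS.
have /hasP hasA : exists2 x, x \in y & x \in A.
  by have [x xA] := set0Pn _ A0; exists x => //; have := subsetP sAY x xA; rewrite inE.
(* The last member [a] of [A] in the order has at least half of the later vertices as
   out-neighbours. These include all [2 * k - 1] of [q], so [k] out-neighbours lie outside [A] and
   one of them avoids [S]. *)
have [y1 [a [y2 [yE aA y2A]]]] :
    exists y1 a y2, [/\ y = y1 ++ a :: y2, a \in A & {in y2, forall x, x \notin A}].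
  elim: (y) hasA => //= z t IHt; have [/IHt[y1 [a [y2 [-> aA y2A]]]] _|noA] := boolP (has _ t).
    by exists (z :: y1), a, y2.
  by rewrite orbF => zA; exists [::], z, t; split=> // x /(hasPn noA).
have sE' : s = y1 ++ a :: (y2 ++ q) ++ [::] by rewrite cats0 sE yE -catA.
have := @median_out _ D y1 a (y2 ++ q) [::]; rewrite -sE' => /(_ meds).
have ua : uniq (a :: y2 ++ q).
  have : uniq s by rewrite (perm_uniq psC) enum_uniq.
  by rewrite sE' cats0 cat_uniq => /and3P[].
move: ua => /= /andP[na uyq]; have := count_out _ _ na; rewrite size_cat sq => cnt le.
have [|b] := @exists_notin _ S [set b in y2 ++ q | D a b].
  have -> : #|[set b in y2 ++ q | D a b]| = count (D a) (y2 ++ q).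
    rewrite -size_filter -(card_uniqP (filter_uniq _ uyq)).
    by apply: eq_card => z; rewrite !inE mem_filter andbC.
  by move=> /=; lia.
rewrite !inE => /andP[byq Dab] bS; exists a, b; split=> //.
  by rewrite -ms sE' cats0 mem_cat inE byq !orbT.
move: byq; rewrite mem_cat => /orP[/y2A // |bq].
by apply/negP=> /(subsetP sAY); rewrite inE => by'; have := yq _ bq; rewrite /= by'.
Qed.

(** With fewer than [k] out-neighbours, [v] has over [k] in-neighbours in each of [X] and [Y]; those
    in [X] become out-neighbours, those in [Y] stay. *)
Lemma flip_degree D k X Y X' v : is_tournament D -> [disjoint X & Y] ->
    v \notin X :|: Y -> X \subset X' -> [disjoint X' & Y] ->
    2 * k <= #|X| -> 2 * k <= #|Y| -> v \in X' -> deg D (X :|: Y) v < k ->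
  k <= deg (flip D X') (X :|: Y) v /\ k <= deg (conv (flip D X')) (X :|: Y) v.
Proof.
move=> tD dXY vXY sXX dX'Y cX cY vX'; rewrite !deg_setU // => lt.
have /norP[vX vY] : ~~ ((v \in X) || (v \in Y)) by rewrite -in_setU.
have -> : deg (flip D X') X v = deg (conv D) X v.
  by apply: eq_deg => u /(subsetP sXX) uX; rewrite /flip vX' uX.
have -> : deg (conv (flip D X')) Y v = deg (conv D) Y v.
  by apply: eq_deg => u uY; rewrite /conv /flip (disjointFl dX'Y uY).
have := cardsD1 v X; have := cardsD1 v Y; rewrite (negPf vX) (negPf vY).
have := deg_conv X v tD; have := deg_conv Y v tD; lia.
Qed.

(* The vertices of [P] act as sources and those of [Q], the end of a median
   order of [C], as sinks: inverting [P :|: Q] closes the cycle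
   [P -> Y -> Q -> P].  A vertex outside [P :|: C] is added to the inverted set
   exactly when it has too few in- or out-neighbours in [P :|: C]. *)
Lemma dominated_flip_no_cut D k P C : is_tournament D -> 0 < k -> k <= #|P| ->
    6 * k <= #|C| -> (forall p c, p \in P -> c \in C -> D p c) ->
  exists X, forall A B, ~~ cut k (flip D X) A B.
Proof.
move=> tD k0 cP cC PC.
have [Y [Q [CE dYQ cQ cY [inQ outY]]]] := median_split tD k0 cC.
have dPC : [disjoint P & C].
  apply/pred0P=> x /=; apply/negP=> /andP[xP xC].
  by have := PC x x xP xC; rewrite (negPf (tD.1 x)).
have sYC : Y \subset C by rewrite CE subsetUl.
have sQC : Q \subset C by rewrite CE subsetUr.
pose X0 := P :|: Q; pose U := X0 :|: Y.
pose X := X0 :|: [set v in ~: U | (deg D U v < k) || (deg (conv D) U v < k)].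
have dXY : [disjoint X & Y].
  apply/pred0P=> x /=; apply/negP=> /andP[xX xY]; move: xX.
  rewrite !inE xY (disjointFr dYQ xY) orbT /= orbF.
  by rewrite (disjointFl dPC (subsetP sYC _ xY)).
have sX0X : X0 \subset X by apply: subsetUl.
have dX0Y : [disjoint X0 & Y] by apply: disjointWl sX0X dXY.
have cX0 : 2 * k <= #|X0|.
  have := cardsUI P Q; rewrite (_ : P :&: Q = set0) ?cards0; first by rewrite /X0; lia.
  by apply/eqP; rewrite setI_eq0; apply: disjointWr dPC.
have YX y : y \in Y -> (y \in X) = false by apply: disjointFl.
have PX p : p \in P -> p \in X by move=> pP; rewrite !inE pP.
have QX q : q \in Q -> q \in X by move=> qQ; rewrite !inE qQ orbT.
set D' := flip D X.
have degU v : v \notin U -> k <= deg D' U v /\ k <= deg (conv D') U v.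
  move=> vU; have [vX|vX] := boolP (v \in X).
    move: (vX); rewrite in_setU => /orP[vX0|].
      by case/negP: vU; rewrite inE vX0.
    rewrite inE => /andP[_ /orP[lt|lt]].
      exact: flip_degree.
    have := flip_degree (tournament_conv tD) dX0Y vU sX0X dXY cX0 cY vX lt.
    by rewrite deg_flip_conv deg_conv_flip_conv => -[].
  have : (k <= deg D U v) && (k <= deg (conv D) U v).
    by apply: contraNT vX; rewrite negb_and -!ltnNge !inE in vU * => ->; rewrite vU orbT.
  rewrite deg_flip_out //.
  have -> : deg (conv D') U v = deg (conv D) U v.
    by apply: eq_deg => u _; rewrite /conv /D' /flip (negPf vX) andbF.
  by case/andP.
exists X => A B; apply/negP=> /cutP[A0 B0 dAB cS noarc].
set S := ~: (A :|: B) in cS.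
have inU_cases x : x \in U -> [|| x \in P, x \in Q | x \in Y] by rewrite !inE orbA.
have D'PY p y : p \in P -> y \in Y -> D' p y.
  by move=> pP yY; rewrite /D' /flip (YX _ yY) andbF PC // (subsetP sYC).
have D'QP q p : q \in Q -> p \in P -> D' q p.
  by move=> qQ pP; rewrite /D' /flip QX // PX // PC // (subsetP sQC).
have D'Y y v : y \in Y -> D' y v = D y v by move=> yY; rewrite /D' /flip (YX _ yY).
have [q qQ qS] : exists2 q, q \in Q & q \notin S by apply: exists_notin; lia.
(* If [P] meets [A], then [Y], [Q] and [P] miss [B] in turn along the cycle. So [B] lies outside
   [U], where each vertex has [k] in-neighbours in [U], one of them in [A]. *)
have [PA|[p]] := set_0Vmem (P :&: A); last first.
  rewrite inE => /andP[pP pA].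
  have YB y : y \in Y -> y \notin B.
    by move=> yY; apply/negP=> yB; have := noarc p y pA yB; rewrite -/D' D'PY.
  have QB z : z \in Q -> z \notin B.
    move=> zQ; apply/negP=> zB.
    have [|y] := @exists_notin _ S [set y in Y | conv D z y].
      exact: leq_trans cS (inQ z zQ).
    rewrite inE => /andP[yY Dyz] yS; have yA := in_setUC_r yS (YB _ yY).
    by have := noarc y z yA zB; rewrite -/D' D'Y // [D y z]Dyz.
  have qA := in_setUC_r qS (QB _ qQ).
  have PB z : z \in P -> z \notin B.
    by move=> zP; apply/negP=> zB; have := noarc q z qA zB; rewrite -/D' D'QP.
  have UB z : z \in U -> z \notin B by move/inU_cases=> /or3P[/PB|/QB|/YB].
  have [b bB] := set0Pn _ B0; have bU : b \notin U by apply: contraL bB => /UB.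
  have [|u] := @exists_notin _ S [set u in U | conv D' b u].
    exact: leq_trans cS (degU b bU).2.
  rewrite inE => /andP[uU Dub] uS; have uA := in_setUC_r uS (UB _ uU).
  by have := noarc u b uA bB; rewrite [flip _ _ _ _]Dub.
have PA' z : z \in P -> z \notin A.
  by move=> zP; apply/negP=> zA; have := in_set0 z; rewrite -PA inE zP zA.
(* Otherwise [P] meets [B], and [Q] and [Y] miss [A]: an arc leaving [A :&: Y] given by the median
   order would end in [B]. *)
have [p pP pS] : exists2 p, p \in P & p \notin S by apply: exists_notin; lia.
have pB := in_setUC_l pS (PA' _ pP).
have QA z : z \in Q -> z \notin A.
  by move=> zQ; apply/negP=> zA; have := noarc z p zA pB; rewrite -/D' D'QP.
have [AY|[z]] := set_0Vmem (A :&: Y); last first.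
  move=> zAY; have [|a [b [aAY bC bAY bS Dab]]] := outY (A :&: Y) S _ (subsetIr _ _) cS.
    by apply/set0Pn; exists z.
  have /setIP[aA aY] := aAY.
  have bA : b \notin A.
    move: bC; rewrite CE inE => /orP[bY|/QA //].
    by move: bAY; rewrite inE bY andbT.
  have := noarc a b aA (in_setUC_l bS bA).
  by rewrite -/D' D'Y // Dab.
have UA z : z \in U -> z \notin A.
  move/inU_cases=> /or3P[/PA'|/QA|zY] //.
  by apply/negP=> zA; have := in_set0 z; rewrite -AY inE zY zA.
have [a aA] := set0Pn _ A0; have aU : a \notin U by apply: contraL aA => /UA.
have [|u] := @exists_notin _ S [set u in U | D' a u].
  exact: leq_trans cS (degU a aU).1.
rewrite inE => /andP[uU Dau] uS; have uB := in_setUC_l uS (UA _ uU).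
by have := noarc a u aA uB; rewrite -/D' Dau.
Qed.

(** * Minimum degree after one inversion, and the remaining cuts *)

Lemma deg_flip_low D d e X v : is_tournament D -> v \in X -> d + e <= #|X| ->
    d + e <= #|~: X| -> deg D setT v < e ->
  d <= deg (flip D X) setT v /\ d <= deg (conv (flip D X)) setT v.
Proof.
move=> tD vX cX cY; rewrite (deg_setT D X) => lt.
rewrite -deg_flip_conv !deg_flip_in //.
(* There are at least [d] in-neighbours on each side of [X]; the inner ones are reversed, the outer
   ones kept. *)
have := deg_conv X v tD; have := deg_conv (~: X) v tD.
have := cardsD1 v X; have := cardsD1 v (~: X); rewrite !inE vX /=.
have -> : deg (conv (conv D)) X v = deg D X v by [].
lia.
Qed.

Lemma deg_flip_low_degree D d e X v : is_tournament D -> v \in X ->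
    d + e <= #|X| -> d + e <= #|~: X| -> v \in low_degree D e ->
  d <= deg (flip D X) setT v /\ d <= deg (conv (flip D X)) setT v.
Proof.
move=> tD vX cX cY; rewrite inE => /orP[|]; first exact: deg_flip_low.
move/(deg_flip_low (tournament_conv tD) vX cX cY) => -[le1 le2].
by split; [rewrite -deg_conv_flip_conv | rewrite -deg_flip_conv].
Qed.

Lemma deg_flip_notin D d X v : v \notin X -> v \notin low_degree D d ->
  d <= deg (flip D X) setT v /\ d <= deg (conv (flip D X)) setT v.
Proof.
move=> vX; rewrite inE negb_or -!leqNgt => /andP[le1 le2].
rewrite deg_flip_out //; split=> //; apply: leq_trans le2 _.
by rewrite (@eq_deg _ (conv (flip D X))) // => u _; rewrite /conv /flip (negPf vX) andbF.
Qed.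

Lemma deg_flip_high D d X v : v \in X -> v \notin low_degree D (d + #|X|) ->
  d <= deg (flip D X) setT v /\ d <= deg (conv (flip D X)) setT v.
Proof.
move=> vX; rewrite inE negb_or -!leqNgt !(deg_setT _ X) => /andP[le1 le2].
have -> : deg (flip D X) (~: X) v = deg D (~: X) v.
  by apply: eq_deg => u; rewrite inE /flip => /negPf->; rewrite andbF.
have -> : deg (conv (flip D X)) (~: X) v = deg (conv D) (~: X) v.
  by apply: eq_deg => u; rewrite inE /conv /flip => /negPf->.
have := deg_le_card D X v; have := deg_le_card (conv D) X v; lia.
Qed.

(* If many vertices have degree below [3 * d], invert [4 * d] of them;
   otherwise pad the vertices of degree below [d] with vertices of degree at
   least [3 * d], which can afford to lose [2 * d] neighbours. *)
Lemma exists_flip_min_degree D d : is_tournament D -> 8 * d <= #|V| ->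
  exists2 X : {set V}, #|X| <= 4 * d & forall v,
    d <= deg (flip D X) setT v /\ d <= deg (conv (flip D X)) setT v.
Proof.
move=> tD dn; have cL := card_low_degree d tD.
have cardC X : #|X| + #|~: X| = #|V| by rewrite cardsC.
have [le|lt] := leqP (4 * d) #|low_degree D (3 * d)|.
  have sL : low_degree D d \subset low_degree D (3 * d).
    by apply/subsetP=> v; rewrite !inE => /orP[]; lia.
  have [|X [sLX sXL cX]] := @exists_card_between _ _ _ (4 * d) sL; first by rewrite cL.
  exists X => [|v]; first by rewrite cX.
  have := cardC X; have [vX|vX] := boolP (v \in X) => cXC.
    by apply: (@deg_flip_low_degree _ _ (3 * d)) => //; [lia | lia | apply: (subsetP sXL)].
  by apply: deg_flip_notin => //; apply: contra vX; apply: (subsetP sLX).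
(* Size [2 * d] suffices for the vertices of degree below [d]. A padding vertex occurs only if
   [#|X| = 2 * d], so it keeps [d] of its [3 * d] neighbours either way. *)
pose m := maxn (2 * d) #|low_degree D d|.
have [|X [sLX sXL cX]] := @exists_card_between _ _ _ m
    (subsetUl (low_degree D d) (~: low_degree D (3 * d))).
  rewrite leq_maxr; have := subset_leq_card (subsetUr (low_degree D d) (~: low_degree D (3 * d))).
  have := cardC (low_degree D (3 * d)); rewrite /m; lia.
exists X => [|v]; first by rewrite cX /m; lia.
have := cardC X; have [vX|vX] := boolP (v \in X) => cXC; last first.
  by apply: deg_flip_notin => //; apply: contra vX; apply: (subsetP sLX).
have [vL|vL] := boolP (v \in low_degree D d).
  by apply: (@deg_flip_low_degree _ _ d) => //; rewrite ?cX /m; lia.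
have cX2 : #|X| <= 2 * d.
  rewrite leqNgt; apply/negP=> ltX; have eqL : low_degree D d = X.
    by apply/eqP; rewrite eqEcard sLX cX /m; move: ltX; rewrite cX /m; lia.
  by rewrite eqL vX in vL.
apply: deg_flip_high => //; have := subsetP sXL v vX.
rewrite in_setU (negPf vL) inE /=; apply: contra; rewrite !inE => /orP[]; lia.
Qed.

(* [B] dominates the non-inverted part of [A] already in [D]; and [B] cannot be
   small since some vertex of [B] has at most [#|B|./2] in-neighbours in [B]. *)
Lemma large_cut_flip_no_cut D k d X A B : is_tournament D -> 0 < k -> 3 * k <= 2 * d + 3 ->
    (forall v, d <= deg (conv (flip D X)) setT v) ->
    cut k (flip D X) A B -> 6 * k <= #|A :\: X| ->
  exists X', forall A' B', ~~ cut k (flip D X') A' B'.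
Proof.
move=> tD k0 kd degd cutAB cA.
have /cutP[A0 B0 dAB cS noarc] := cutAB; set D' := flip D X in degd noarc.
apply: (@dominated_flip_no_cut D k B (A :\: X)) => //; last first.
  move=> b a bB; rewrite inE => /andP[aX aA]; have := noarc a b aA bB.
  rewrite /D' /flip (negPf aX) -tournamentC //.
  by apply: contraTneq bB => <-; rewrite (disjointFr dAB aA).
(* In-neighbours of [v] outside [B] are among fewer than [k] vertices, so twice its in-degree is at
   most [(k - 2) + 2 * (k - 1) < 2 * d]. *)
rewrite leqNgt; apply/negP=> ltB.
have [v vB lt] := exists_low_deg (tournament_conv (tournament_flip X tD)) B0.
have := degd v; rewrite leqNgt => /negP; apply.
have : deg (conv D') setT v <= deg (conv D') B v + #|~: (A :|: B)|.
  rewrite (leq_trans _ (leq_card_setU _ _)) //; apply: subset_leq_card.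
  apply/subsetP=> u; rewrite !inE /conv /= => Duv; rewrite Duv andbT negb_or.
  case uB: (u \in B) => //=; rewrite andbT; apply: contraL Duv => uA.
  exact: noarc.
rewrite -/D' in lt; lia.
Qed.

Lemma exists_flip_no_cut D k : is_tournament D -> 0 < k -> 19 * k - 2 <= #|V| ->
  exists X, forall A B, ~~ cut k (flip D X) A B.
Proof.
(* This is the least [d] with [3 * k <= 2 * d + 3]. *)
move=> tD k0 kn; pose d := (3 * k - 2)./2.
have [|X cX degX] := @exists_flip_min_degree D d tD; first by rewrite /d; lia.
have [/existsP[[A B] /= cutAB]|] := boolP [exists p : {set V} * {set V},
    cut k (flip D X) p.1 p.2]; last first.
  by rewrite negb_exists => /forallP noX; exists X => A B; apply: (noX (A, B)).
(* Otherwise there are at most [4 * d + (k - 1) + 2 * (6 * k - 1) <= 19 * k - 7] vertices. *)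
have : 6 * k <= #|A :\: X| \/ 6 * k <= #|B :\: X|.
  have /cutP[_ _ _ cS _] := cutAB.
  have sV : [set: V] \subset X :|: ~: (A :|: B) :|: (A :\: X) :|: (B :\: X).
    by apply/subsetP=> v _; rewrite !inE; case: (v \in X); case: (v \in A); case: (v \in B).
  have := subset_leq_card sV; rewrite cardsT.
  do 3!rewrite cardsU; rewrite /d in cX; lia.
case=> [cA|cB].
  by apply: (@large_cut_flip_no_cut D k d X A B) => // [|v]; [rewrite /d; lia | case: (degX v)].
have [|||X' noX'] := @large_cut_flip_no_cut (conv D) k d X B A (tournament_conv tD) k0 _ _ _ cB.
- by rewrite /d; lia.
- by move=> v; rewrite deg_conv_flip_conv; case: (degX v).
- by apply: eq_cut (cut_conv cutAB) => u v; rewrite flip_conv.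
exists X' => A' B'; apply: contra (noX' B' A') => /cut_conv; apply: eq_cut => u v.
by rewrite flip_conv.
Qed.

End Tournaments.

(** * Strong connectivity *)

Section StrongConnectivity.
Variables (n k : nat).
Local Notation V := 'I_n.
Implicit Types (D : rel V) (A B S X : {set V}).

(** If [S] separates [u] from [v], the vertices reached from [u] and the others outside [S] form a
    cut. *)
Lemma no_cut_vertex_strong D : k < n -> (forall A B, ~~ cut k D A B) ->
  vertex_strong k D.
Proof.
move=> kn noD; split=> // S cS u v uS vS; set e := rel_of_simpl _.
apply: contraTT isT => nuv; pose A := [set w | connect e u w].
have AS w : w \in A -> w \notin S.
  rewrite inE => /(@connect_exit _ _ (~: S)); case/boolP: (w \in S) => // wS [].
  - by rewrite inE.
  - by rewrite inE wS.
  by move=> x [y [_]]; rewrite inE negbK => yS /and3P[_ _]; rewrite yS.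
have /negP[] := noD A (~: (A :|: S)); apply/cutP; split.
- by apply/set0Pn; exists u; rewrite inE connect0.
- by apply/set0Pn; exists v; rewrite !inE negb_or nuv.
- by rewrite disjoints_subset setCK subsetUl.
- apply: leq_ltn_trans cS; apply: subset_leq_card; apply/subsetP=> w.
  by rewrite !inE; case: (connect e u w) => //=; rewrite negbK.
move=> a b aA; rewrite inE in_setU negb_or => /andP[bA bS].
apply: contra bA => Dab; have aS := AS a aA.
rewrite !inE in aA *; apply: (connect_trans aA); apply: connect1.
by rewrite /e /= Dab bS aS.
Qed.

(* If [a] and [b] on the two sides of [A] are not joined by an arc, each arc
   leaving [A] has an end other than [a] and [b]; deleting one such end per arc
   separates [a] from [b]. *)
Lemma vertex_strong_arc_strong D : vertex_strong k D -> arc_strong k D.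
Proof.
case=> kn strongD A A0 AT; set E := finset _.
rewrite leqNgt; apply/negP=> ltE.
(* If all these pairs are arcs, their number [a * b] is at least [a + b - 1 = n - 1 >= k]. *)
have [sE|] := boolP (setX A (~: A) \subset E).
  have a0 : 0 < #|A| by rewrite card_gt0.
  have b0 : 0 < #|~: A|.
    by rewrite card_gt0; apply: contra AT => /eqP; rewrite -setCT => /setC_inj ->.
  have le : #|A| * #|~: A| <= #|E| by rewrite -cardsX subset_leq_card.
  have eqn : #|A| + #|~: A| = n by rewrite cardsC card_ord.
  move: a0 b0 le eqn ltE kn; move: #|A| #|~: A| #|E| => a b c; nia.
case/subsetPn=> -[a b]; rewrite !inE /= => /andP[aA bA]; rewrite aA bA /= => nab.
(* The chosen end is never [b]: a tail lies in [A], and the head is chosen only for arcs from [a],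
   which has no arc to [b]. *)
pose f (p : V * V) := if p.1 == a then p.2 else p.1.
have cS : #|f @: E| < k by apply: leq_ltn_trans (leq_imset_card _ _) ltE.
have aS : a \notin f @: E.
  apply/imsetP=> -[[x y]]; rewrite inE /f /= => /and3P[xA yA _].
  by case: eqVneq => [_ ya|/eqP + xa]; [rewrite -ya aA in yA | case].
have bS : b \notin f @: E.
  apply/imsetP=> -[[x y]]; rewrite inE /f /= => /and3P[xA yA Dxy].
  case: eqVneq => [xa by'|_ bx]; last by rewrite bx xA in bA.
  by rewrite by' -xa Dxy in nab.
have [x [y [xA yA /and3P[Dxy xS yS]]]] := connect_exit (strongD _ cS a b aS bS) aA bA.
have : f (x, y) \in f @: E by apply: imset_f; rewrite inE /= xA yA.
by rewrite /f /=; case: ifP => _ h; [rewrite h in yS | rewrite h in xS].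
Qed.

(** * Decidability and the values of the two minima *)

Lemma arc_strong_dec D : arc_strong k D \/ ~ arc_strong k D.
Proof.
pose arcs A := #|[set p : V * V | [&& p.1 \in A, p.2 \notin A & D p.1 p.2]]|.
case: (boolP [forall A : {set V}, (A != set0) ==> (A != setT) ==> (k <= arcs A)]).
  by move/forallP=> h; left=> A A0 AT; have := h A; rewrite A0 AT.
by move=> nh; right=> h; case/forallP: nh => A; apply/implyP=> A0; apply/implyP=> /(h A A0).
Qed.

(** For [k < n], being [k]-strong amounts to the absence of cuts, a boolean condition. *)
Lemma vertex_strong_dec D : vertex_strong k D \/ ~ vertex_strong k D.
Proof.
have [kn|kn] := boolP (k < n); last by right=> -[]; rewrite (negPf kn).
case: (boolP [exists p : {set V} * {set V}, cut k D p.1 p.2]); last first.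
  rewrite negb_exists => /forallP noD; left; apply: no_cut_vertex_strong => // A B.
  exact: (noD (A, B)).
case/existsP=> -[A B] /cutP /= [/set0Pn[a aA] /set0Pn[b bB] dAB cS noarc].
right=> -[_ /(_ _ cS a b)]; rewrite !inE !negbK aA bB orbT => /(_ isT isT) ab.
have bA : b \notin A by rewrite (disjointFl dAB bB).
have [x [y [xA yA /and3P[Dxy _]]]] := connect_exit ab aA bA.
rewrite !inE negbK (negPf yA) /= => yB.
by have := noarc x y xA yB; rewrite Dxy.
Qed.

(** The decision on [Pr D] tells whether the minimum is 0 or 1; the clause [Pr D -> m = 0] serves to
    compare two minima. *)
Lemma is_min_inv01 (Pr : rel V -> Prop) D X : Pr D \/ ~ Pr D ->
  Pr (invert D X) -> exists2 m, is_min_inv Pr D m & m <= 1 /\ (Pr D -> m = 0).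
Proof.
move=> [PD _|nPD PDX].
  by exists 0 => //; split=> [|//]; exists [::].
exists 1; last by split=> // /nPD.
by split=> [|[|Y Ys] // /nPD //]; exists [:: X].
Qed.

End StrongConnectivity.

Theorem theorem1p10 (n k : nat) : 0 < k -> 19 * k - 2 <= n ->
  forall T : rel 'I_n, tournament T ->
  exists a b : nat, is_sinv_arc k T a /\ is_sinv k T b /\ a <= b /\ b <= 1.
Proof.
move=> k0 kn T tT; have [X noX] := @exists_flip_no_cut _ T k tT k0 ltac:(by rewrite card_ord).
have vX : vertex_strong k (invert T X) by apply: no_cut_vertex_strong => //; lia.
have [b minb [b1 _]] := is_min_inv01 (vertex_strong_dec k T) vX.
have [a mina [a1 a0]] :=
  is_min_inv01 (arc_strong_dec k T) (vertex_strong_arc_strong vX).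
exists a, b; do 3!split=> //.
(* If [b] is 0, then [T] is already [k]-strong, hence [k]-arc-strong, and [a] is 0 too. *)
case: b minb b1 => [|b] minb b1; last exact: leq_trans a1 _.
case: minb => -[[|X0 Xs] [//= _ vT]] _.
by rewrite (a0 (vertex_strong_arc_strong vT)).
Qed.
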